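(* There exists a hereditary graph class $\mathcal C$ with the following properties. 1. For every integer $r\ge 1$, the class $\mathcal C_r=\{H\in\mathcal C:\omega(H)\le r\}$ has bounded layered treewidth. 2. The class $\mathcal C$ has unbounded layered tree-independence number.
   Context: All graphs are finite, simple and nonempty. A graph class is hereditary if it is closed under taking induced subgraphs. $\omega$ and $\alpha$ denote clique number and independence number. A layering of $G$ is an ordered partition $(V_i)_{i\in\mathbb Z}$ of $V(G)$ (parts may be empty) such that for every edge $uv$ with $u\in V_i$ and $v\in V_j$ we have $|i-j|\le 1$. Let $\mathcal T=(T,\{X_t\}_{t\in V(T)})$ be a tree decomposition of $G$. The layered width (resp. layered independence number) of $\mathcal T$ is the minimum integer $\ell$ such that there is a layering $(V_i)_{i\in\mathbb Z}$ of $G$ with $|X_t\cap V_i|\le\ell$ (resp. $\alpha(G[X_t\cap V_i])\le\ell$) for all $t\in V(T)$ and $i\in\mathbb Z$. The layered treewidth (resp. layered tree-independence number) of $G$ is the minimum layered width (resp. layered independence number) of a tree decomposition of $G$. A class has bounded layered treewidth (resp. layered tree-independence number) if some constant bounds this parameter for all its graphs, and unbounded otherwise. *)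

(* Defs.v *)
From mathcomp Require Import all_boot all_order all_algebra.
From mathcomp Require Import boolp.

Set Implicit Arguments.
Unset Strict Implicit.
Unset Printing Implicit Defensive.

Import Order.TTheory GRing.Theory Num.Theory.

(* The null graph is allowed here so that G[S] makes sense for every S;
   nonemptiness is required of trees and of the members of a graph class. *)
Record sgraph := SGraph {
  vertex :> finType;
  adj : rel vertex;
  adj_sym : symmetric adj;
  adj_irr : irreflexive adj }.

Definition nonempty_graph (G : sgraph) : Prop := 0 < #|G|.

Definition isomorphic (G H : sgraph) : Prop :=
  exists f : G -> H, bijective f /\ forall x y, adj (f x) (f y) = adj x y.

Section Induced.
Variables (G : sgraph) (S : {set G}).

Definition induced_adj : rel {x : G | x \in S} :=
  fun x y => adj (val x) (val y).

Lemma induced_sym : symmetric induced_adj.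
Proof. by move=> x y; apply: adj_sym. Qed.

Lemma induced_irr : irreflexive induced_adj.
Proof. by move=> x; apply: adj_irr. Qed.

Definition induced : sgraph := SGraph induced_sym induced_irr.
End Induced.

Definition clique (G : sgraph) (A : {set G}) : bool :=
  [forall x in A, forall y in A, (x != y) ==> adj x y].

Definition stable (G : sgraph) (A : {set G}) : bool :=
  [forall x in A, forall y in A, ~~ adj x y].

Definition omega (G : sgraph) : nat := \max_(A : {set G} | clique A) #|A|.

Definition alpha (G : sgraph) : nat := \max_(A : {set G} | stable A) #|A|.

Definition connected (G : sgraph) : Prop := forall x y : G, connect (@adj G) x y.

(* [ucycle] also accepts [::] and the walk [:: x; y] along an edge and back;
   graph cycles are those of length at least 3. *)
Definition acyclic (G : sgraph) : Prop :=
  forall c : seq G, ucycle (@adj G) c -> size c < 3.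

Definition is_tree (T : sgraph) : Prop :=
  [/\ nonempty_graph T, connected T & acyclic T].

Record tree_decomposition (G : sgraph) := TreeDecomposition {
  td_tree : sgraph;
  bag : td_tree -> {set G};
  td_treeP : is_tree td_tree;
  td_vertexP : forall v : G, exists t, v \in bag t;
  td_edgeP : forall u v : G, adj u v -> exists t, (u \in bag t) && (v \in bag t);
  td_subtreeP : forall v : G, connected (induced [set t | v \in bag t]) }.

(* A layering (V_i) indexed by the integers is given by the function sending
   each vertex to the index of its part. *)
Definition is_layering (G : sgraph) (L : G -> int) : Prop :=
  forall u v : G, adj u v -> (`|L u - L v| <= 1)%R.

Definition layer (G : sgraph) (L : G -> int) (i : int) : {set G} :=
  [set v | L v == i].

Lemma ex_asbool (P : nat -> Prop) : (exists n, P n) -> exists n, `[< P n >].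
Proof. by case=> n Pn; exists n; apply/asboolP. Qed.

Definition min_nat (P : nat -> Prop) (exP : exists n, P n) : nat :=
  ex_minn (ex_asbool exP).

Lemma min_natP (P : nat -> Prop) (exP : exists n, P n) :
  P (min_nat exP) /\ forall n, P n -> min_nat exP <= n.
Proof.
rewrite /min_nat; case: ex_minnP => m /asboolP Pm minm; split=> // n Pn.
by apply: minm; apply/asboolP.
Qed.

Section LayeredParameters.
Variable G : sgraph.

Definition layered_width_spec (D : tree_decomposition G) (l : nat) : Prop :=
  exists L : G -> int, is_layering L /\
    forall (t : td_tree D) (i : int), #|bag t :&: layer L i| <= l.

Definition layered_indep_spec (D : tree_decomposition G) (l : nat) : Prop :=
  exists L : G -> int, is_layering L /\
    forall (t : td_tree D) (i : int), alpha (induced (bag t :&: layer L i)) <= l.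

Lemma layering_cst : @is_layering G (fun=> 0%R).
Proof. by move=> u v _; rewrite subrr normr0. Qed.

Lemma layered_width_ex (D : tree_decomposition G) :
  exists l, layered_width_spec D l.
Proof.
exists #|G|, (fun=> 0%R); split; first exact: layering_cst.
by move=> t i; apply: max_card.
Qed.

Lemma layered_indep_ex (D : tree_decomposition G) :
  exists l, layered_indep_spec D l.
Proof.
exists #|G|, (fun=> 0%R); split; first exact: layering_cst.
move=> t i; apply/bigmax_leqP => A _; apply: leq_trans (max_card _) _.
by rewrite card_sig; apply: max_card.
Qed.

Definition layered_width (D : tree_decomposition G) : nat :=
  min_nat (layered_width_ex D).

Definition layered_independence_number (D : tree_decomposition G) : nat :=
  min_nat (layered_indep_ex D).

Lemma unit_adj_sym : symmetric (fun _ _ : unit => false). Proof. by []. Qed.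
Lemma unit_adj_irr : irreflexive (fun _ _ : unit => false). Proof. by []. Qed.
Definition one_vertex : sgraph := SGraph unit_adj_sym unit_adj_irr.

Lemma one_vertex_tree : is_tree one_vertex.
Proof.
split; first by rewrite /nonempty_graph card_unit.
  by case; case; apply: connect0.
by case=> [|x [|y [|z c]]].
Qed.

Lemma trivial_decomposition : exists _ : tree_decomposition G, True.
Proof.
unshelve eexists; last by [].
apply: (@TreeDecomposition G one_vertex (fun=> setT) one_vertex_tree).
- by move=> v; exists tt; rewrite inE.
- by move=> u v _; exists tt; rewrite !inE.
- move=> v [[] px] [[] py]; rewrite (bool_irrelevance px py).
  exact: connect0.
Qed.

Lemma layered_treewidth_ex :
  exists k, exists D : tree_decomposition G, layered_width D = k.
Proof. by have [D _] := trivial_decomposition; exists (layered_width D), D. Qed.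

Lemma layered_tree_indep_ex :
  exists k, exists D : tree_decomposition G, layered_independence_number D = k.
Proof.
by have [D _] := trivial_decomposition; exists (layered_independence_number D), D.
Qed.

Definition layered_treewidth : nat := min_nat layered_treewidth_ex.

Definition layered_tree_independence_number : nat :=
  min_nat layered_tree_indep_ex.
End LayeredParameters.

(* Classes are closed under isomorphism, as graphs are considered up to
   isomorphism. *)
Definition graph_class (C : sgraph -> Prop) : Prop :=
  (forall G, C G -> nonempty_graph G) /\
  (forall G H, isomorphic G H -> C G -> C H).

Definition hereditary (C : sgraph -> Prop) : Prop :=
  forall (G : sgraph) (S : {set G}), S != set0 -> C G -> C (induced S).

Definition omega_at_most (C : sgraph -> Prop) (r : nat) : sgraph -> Prop :=
  fun H => C H /\ omega H <= r.

Definition bounded_on (p : sgraph -> nat) (C : sgraph -> Prop) : Prop :=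
  exists c : nat, forall G, C G -> p G <= c.

(* Main.v *)
Require Import Defs.
From mathcomp Require Import all_boot.
From mathcomp Require Import all_algebra zify.

Set Implicit Arguments.
Unset Strict Implicit.
Unset Printing Implicit Defensive.

(** If a tree decomposition has bags of independence number at most k, then
    Ramsey's theorem bounds its bags by a function of k and the clique number,
    polynomial in the latter for fixed k.  Hence it suffices to find graphs
    whose treewidth is huge compared with their clique number, although their
    induced subgraphs of smaller clique number have small treewidth.  Layerings
    are neutralised by adding an apex, which squeezes the whole graph into three
    layers and adds at most one to the size of every bag.

    The graphs are layered wheels.  Vertices are pairs (level, column); the
    parent of (j+1, x) is (j, x / d).  Consecutive vertices of a level are
    adjacent, and the children of v choose their upward neighbourhoods among v
    and the upward neighbours of v: the letter [x mod d] of a child is a set of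
    at most r+1 levels, and the child keeps exactly the elements on these levels.
    Upward neighbourhoods are therefore cliques of at most r+1 vertices, and
    cliques of the wheel have bounded size ([wheel_clique]), whatever the number
    of levels.  Every such set of levels is the letter of some child of v.

    Any two levels touch and every level is a path, so by a Helly argument in
    trees ([bramble_bag]) some bag of any tree decomposition meets all levels.
    With more than 3 * 2^(2r+6) levels, one of the three layers contains
    2^(2r+6) vertices of that bag, hence r+1 independent ones
    ([cone_layered_tree_indep]).

    Conversely, let H be an induced subgraph of the wheel with clique number at
    most r+1.  For every vertex v of the wheel, the elements of H among v and
    its upward neighbours form a clique, small enough for some child of v, its
    heir, to keep all of them.  Following heirs down to the last level gives a
    vertical chain below v; its members in H, together with the elements kept at
    v, still form a clique, the core of v.  These chains cut the wheel into
    strips: the strip between two consecutive vertices u, u' of a level is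
    separated from the rest of H by the cores of u and u', and it is divided
    into the strips between consecutive vertices of the next level.  Taking for
    each strip the two cores that bound it and the two that bound the enclosing
    strip yields a tree decomposition with bags of at most four cliques
    ([wheel_decomposition]).  The subgraphs of larger clique number come from
    finitely many wheels and have bounded order. *)

(** * Rooted trees *)

Section RootedTree.
Variables (T : finType) (root : T) (par : T -> T) (rank : T -> nat).
Hypothesis rank_par : forall t, t != root -> rank (par t) < rank t.

Definition parent_adj : rel T := fun x y =>
  ((x != root) && (par x == y)) || ((y != root) && (par y == x)).

Lemma parent_adj_sym : symmetric parent_adj.
Proof. by move=> x y; rewrite /parent_adj orbC. Qed.

Lemma parent_adj_irr : irreflexive parent_adj.
Proof.
move=> x; rewrite /parent_adj orbb; apply/negP => /andP[/rank_par xr /eqP e].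
by rewrite e ltnn in xr.
Qed.

Definition parent_tree : sgraph := SGraph parent_adj_sym parent_adj_irr.

(** In a cycle, an element of largest rank has two distinct neighbours, and both
    would have to be its parent. *)
Lemma parent_treeP : is_tree parent_tree.
Proof.
split; first by apply/card_gt0P; exists root.
  have toroot t : connect parent_adj t root.
    have [n le_n] := ubnP (rank t); elim: n t le_n => // n IHn t le_n.
    have [-> //|tr] := eqVneq t root.
    apply: connect_trans (connect1 _) (IHn (par t) _).
      by rewrite /parent_adj tr eqxx.
    by have := rank_par tr; lia.
  move=> x y; apply: connect_trans (toroot x) _.
  by rewrite (sym_connect_sym parent_adj_sym); apply: toroot.
move=> c /andP[cyc_c uniq_c]; rewrite ltnNge; apply/negP => size_c.
have [z0 z0c] : exists z, z \in c by case: c size_c {cyc_c uniq_c} => // a l _; exists a; rewrite mem_head.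
pose z := [arg max_(x > z0 in [pred x | x \in c]) rank x].
have [zc zmax] : z \in c /\ forall y, y \in c -> rank y <= rank z.
  by rewrite /z; case: arg_maxnP.
have only_par y : y \in c -> parent_adj z y -> y = par z.
  move=> yc /orP[/andP[_ /eqP //]|/andP[yr /eqP e]].
  by have := rank_par yr; rewrite e ltnNge zmax.
have [i c' rot_c] := rot_to zc.
have inc y : y \in z :: c' -> y \in c by rewrite -rot_c mem_rot.
move: cyc_c uniq_c size_c; rewrite -(rot_cycle i) -(rot_uniq i) -(size_rot i) rot_c.
case: c' inc {rot_c} => [|y1 c'] // inc.
case/lastP: c' inc => [|c' y2] // inc.
rewrite /= rcons_path last_rcons => /andP[zy1 /andP[_ zy2]] /and3P[_ + _] _.
have e1 : y1 = par z by apply: only_par => //; apply: inc; rewrite !inE eqxx orbT.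
have e2 : y2 = par z.
  apply: only_par; last by rewrite parent_adj_sym.
  by apply: inc; rewrite !(inE, mem_rcons) eqxx !orbT.
by rewrite e1 e2 mem_rcons mem_head.
Qed.

(** Every element climbs within [S] to an element whose parent is missing, so
    [S] spans a subtree as soon as there is only one such element. *)
Lemma parent_subtree (S : {set T}) :
    (forall x y, x \in S -> y \in S ->
       (x == root) || (par x \notin S) -> (y == root) || (par y \notin S) -> x = y) ->
  connected (@induced parent_tree S).
Proof.
move=> top_uniq.
have totop (x : @induced parent_tree S) : exists2 t : @induced parent_tree S,
    connect (@adj (@induced parent_tree S)) x t & (val t == root) || (par (val t) \notin S).
  have [n le_n] := ubnP (rank (val x)); elim: n x le_n => // n IHn x le_n.
  case: (boolP ((val x == root) || (par (val x) \notin S))) => [xtop|]; first by exists x.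
  rewrite negb_or negbK => /andP[xr pxS].
  have [|t xt ttop] := IHn (Sub (par (val x)) pxS).
    by have := rank_par xr; rewrite SubK; lia.
  exists t => //; apply: connect_trans (connect1 _) xt.
  by rewrite /= /induced_adj /= /parent_adj xr eqxx.
move=> x y; have [t xt ttop] := totop x; have [u yu utop] := totop y.
have tu : t = u by apply: val_inj; apply: top_uniq (valP t) (valP u) ttop utop.
apply: connect_trans xt _; rewrite tu.
by rewrite (sym_connect_sym (@adj_sym (@induced parent_tree S))).
Qed.

End RootedTree.

(** * Brambles *)

Definition within (G : sgraph) (A : {set G}) : rel G :=
  fun x y => [&& x \in A, y \in A & adj x y].

Lemma within_sym (G : sgraph) (A : {set G}) : symmetric (within A).
Proof. by move=> x y; rewrite /within adj_sym andbCA. Qed.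

Lemma sub_within (G : sgraph) (A B : {set G}) x y :
  A \subset B -> connect (within A) x y -> connect (within B) x y.
Proof.
move=> /subsetP AB; apply: connect_sub => u v /and3P[uA vA uv].
by apply: connect1; rewrite /within !AB.
Qed.

Lemma induced_connect_within (G : sgraph) (A : {set G}) (x y : induced A) :
  connect (@adj (induced A)) x y -> connect (within A) (val x) (val y).
Proof.
case/connectP=> p; elim: p x => [|z p IHp] x /=; first by move=> _ ->.
case/andP=> xz pth eq_y; apply: connect_trans (connect1 _) (IHp z pth eq_y).
by rewrite /within (valP x) (valP z).
Qed.

Definition connected_set (G : sgraph) (A : {set G}) : Prop :=
  A != set0 /\ {in A &, forall x y, connect (within A) x y}.

Definition touching (G : sgraph) (A B : {set G}) : Prop :=
  exists x y, [/\ x \in A, y \in B & (x == y) || adj x y].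

(** Deleting the edge [t u] of a tree leaves [t] and [u] in different components;
    two walks to [s], one avoiding [t] and the other avoiding [u], would join
    them. *)
Lemma acyclic_edge_cut (T : sgraph) (t u s : T) : acyclic T -> adj t u ->
  connect (within [set~ t]) u s -> connect (within [set~ u]) t s -> False.
Proof.
move=> acT tu us ts.
pose e : rel T := fun x y => adj x y && ~~ (((x == t) && (y == u)) || ((x == u) && (y == t))).
have e_sym : symmetric e.
  by move=> x y; rewrite /e adj_sym; congr (_ && ~~ _); rewrite orbC ![(_ == u) && _]andbC.
have ut : connect e u t.
  apply: (@connect_trans _ _ s).
    apply: connect_sub us => x y /and3P[]; rewrite !inE => xt yt xy.
    by apply: connect1; rewrite /e xy (negPf xt) (negPf yt) andbF.
  rewrite (sym_connect_sym e_sym); apply: connect_sub ts => x y /and3P[]; rewrite !inE => xu yu xy.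
  by apply: connect1; rewrite /e xy (negPf xu) (negPf yu) andbF.
have [p0 pth0 last0] := connectP ut.
case: (shortenP pth0) last0 => p pth uniq_p _ last_p {p0 pth0}.
have := acT (u :: p); rewrite /ucycle uniq_p andbT.
case: p pth uniq_p last_p => [|x [|y p]] pth uniq_p last_p cyc.
- by rewrite /= in last_p; rewrite last_p adj_irr in tu.
- by move: pth; rewrite /= in last_p; rewrite /= /e -last_p !eqxx orbT andbF.
- suff : size [:: u, x, y & p] < 3 by [].
  apply: cyc; rewrite (cycle_path u) /= -[last y p]last_p tu /=.
  by have := sub_path _ pth; apply=> a b /andP[].
Qed.

(** If every bag missed some set of the family, each node [t] would point to its
    neighbour [next t] in the direction of the subtree of bags meeting the set
    missed by [t].  In a finite tree two adjacent nodes then point to each other,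
    which separates the two corresponding sets although they touch. *)
Lemma bramble_bag (G : sgraph) (D : tree_decomposition G) (I : finType) (B : I -> {set G}) :
    (forall i, connected_set (B i)) -> (forall i j, touching (B i) (B j)) ->
  exists t : td_tree D, forall i, bag t :&: B i != set0.
Proof.
move=> Bconn Btouch.
have [/card_gt0P[r _] Tconn Tac] := td_treeP D.
pose good (t : td_tree D) := [forall i, bag t :&: B i != set0].
case: (boolP [exists t, good t]) => [/existsP[t /forallP tP]|]; first by exists t.
move=> /existsPn nogood; exfalso.
have missP (t : td_tree D) : exists i, bag t :&: B i == set0.
  by have /forallPn[i] := nogood t; rewrite negbK; exists i.
pose miss t := xchoose (missP t).
have missE (t : td_tree D) x : x \in bag t -> x \in B (miss t) -> False.
  move=> xt xB; have /eqP/setP/(_ x) := xchooseP (missP t).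
  by rewrite inE xt xB inE.
(* the bags meeting a connected set span a subtree, here one avoiding t *)
have through (t : td_tree D) i : (forall x, x \in bag t -> x \in B i -> False) ->
    forall x y (a b : td_tree D), x \in B i -> y \in B i -> x \in bag a -> y \in bag b ->
      connect (within [set~ t]) a b.
  move=> miss_t x y a b xB yB xa yb.
  have same z c d : z \in B i -> z \in bag c -> z \in bag d -> connect (within [set~ t]) c d.
    move=> zB zc zd.
    have zc' : c \in [set u : td_tree D | z \in bag u] by rewrite inE.
    have zd' : d \in [set u : td_tree D | z \in bag u] by rewrite inE.
    have := induced_connect_within (@td_subtreeP G D z (Sub c zc') (Sub d zd')).
    apply: sub_within; apply/subsetP => u; rewrite !inE => zu; apply/eqP => ut.
    by apply: (miss_t z) => //; rewrite -ut.
  have [_ /(_ x y xB yB)/connectP[p]] := Bconn i.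
  elim: p x a xB xa => [|z p IHp] x a xB xa /=.
    by move=> _ eq_y; apply: (same x) => //; rewrite -eq_y.
  case/andP=> /and3P[_ zB xz] pth lasty.
  have [c /andP[xc zc]] := td_edgeP D xz.
  exact: connect_trans (same x a c xB xa xc) (IHp z c zB zc pth lasty).
have nextP (t : td_tree D) : exists u, adj t u && [exists x, exists a : td_tree D,
    [&& x \in B (miss t), x \in bag a & connect (within [set~ t]) u a]].
  have [/set0Pn[x xB] _] := Bconn (miss t).
  have [a xa] := td_vertexP D x.
  have [p0 pth0 last0] := connectP (Tconn t a).
  case: (shortenP pth0) last0 => p pth uniq_p _ last_p {p0 pth0}.
  case: p pth uniq_p last_p => [|u p] pth uniq_p last_p.
    by case: (missE t x) => //; rewrite -[t]/(last t [::]) -last_p.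
  exists u; move: pth => /= /andP[-> pth] /=.
  apply/existsP; exists x; apply/existsP; exists a; rewrite xB xa /=.
  apply/connectP; exists p => //.
  move: uniq_p => /andP[]; rewrite -/(uniq (u :: p)) => tp _.
  elim: p u tp pth {last_p} => //= v p IHp u tp /andP[uv pth].
  rewrite /within !inE uv; move: tp; rewrite !inE !negb_or => /and3P[tu tv tp].
  by rewrite [u == t]eq_sym tu [v == t]eq_sym tv /= IHp // inE negb_or tv.
have [next next_adj next_side] : exists2 next : td_tree D -> td_tree D,
    forall t, adj t (next t) &
    forall t y b, y \in B (miss t) -> y \in bag b -> connect (within [set~ t]) (next t) b.
  exists (fun t => xchoose (nextP t)) => [t|t y b yB yb].
    by have /andP[] := xchooseP (nextP t).
  have /andP[_ /existsP[x /existsP[a /and3P[xB xa]]]] := xchooseP (nextP t).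
  move=> /connect_trans; apply; apply: (through t (miss t) _ x y) => //.
  exact: missE.
(* a finite functional graph has a cycle; acyclicity makes it a 2-cycle *)
have [t nnt] : exists t, next (next t) = t.
  have /trajectP[i lt_i loop] := looping_order next r.
  have [t loop_t] : exists t, exists k, iter k.+1 next t = t.
    exists (iter i next r), (order next r - i).-1; rewrite prednK ?subn_gt0 //.
    by rewrite -iterD subnK // ltnW.
  have cyc : fcycle next (orbit next t) by apply/(orbitPcycle 3 0).
  have back : iter (order next t) next t = t by apply/(orbitPcycle 3 4).
  have short : size (orbit next t) < 3.
    apply: Tac; rewrite /ucycle orbit_uniq andbT.
    by apply: sub_cycle cyc => x y /eqP <-.
  exists t; move: back short (order_gt0 next t); rewrite size_orbit.
  move: (order next t) => [|[|[|m]]] //= e _ _.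
  by rewrite !e.
have [x [y [xB yB xy]]] := Btouch (miss t) (miss (next t)).
have [b [xb yb]] : exists b : td_tree D, x \in bag b /\ y \in bag b.
  case/orP: xy => [/eqP <-|/(td_edgeP D)[b /andP[xb yb]]]; last by exists b.
  by have [b xb] := td_vertexP D x; exists b.
apply: (@acyclic_edge_cut (td_tree D) t (next t) b) => //.
  exact: next_side xB xb.
by rewrite -{2}nnt; apply: next_side yB yb.
Qed.

(** * Ramsey *)

(** Halving step: a vertex [x] of [X] is joined to, or separated from, at least
    half of the others. *)
Lemma ramsey_pow (G : sgraph) (a b : nat) (X : {set G}) : 2 ^ (a + b) <= #|X| ->
  exists A : {set G}, A \subset X /\
    ((clique A /\ #|A| = a) \/ (stable A /\ #|A| = b)).
Proof.
have [n] := ubnP (a + b); elim: n a b X => // n IHn [|a] [|b] X le_n leX;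
  try by exists set0; rewrite sub0set cards0; split=> //; first
    [by left; split=> //; apply/forall_inP => x; rewrite inE
    |by right; split=> //; apply/forall_inP => x; rewrite inE].
have [x xX] : exists x, x \in X by apply/card_gt0P; apply: leq_trans leX; rewrite expn_gt0.
pose N := [set y in X | adj x y]; pose M := [set y in X :\ x | ~~ adj x y].
have cardX : #|X| = (#|N| + #|M|).+1.
  rewrite (cardsD1 x) xX add1n; congr _.+1.
  rewrite -(cardsID [set y | adj x y] (X :\ x)); congr (_ + _).
    by apply: eq_card => y; rewrite !inE; case: eqP => [->|]; rewrite ?adj_irr ?andbF.
  by apply: eq_card => y; rewrite !inE andbC.
have sub_NX : N \subset X by apply/subsetP => y; rewrite inE => /andP[].
have sub_MX : M \subset X by apply/subsetP => y; rewrite !inE => /andP[/andP[]].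
have [leN|ltN] := leqP (2 ^ (a + b.+1)) #|N|.
  have [||A [AN [[clA cA]|stA]]] := IHn a b.+1 N; [lia|by []| |]; last first.
    by exists A; split; [exact: subset_trans sub_NX | right].
  exists (x |: A); split; first by rewrite subUset sub1set xX (subset_trans AN).
  have Nx y : y \in A -> adj x y by move=> /(subsetP AN); rewrite inE => /andP[].
  left; split; last first.
    rewrite cardsU1 cA; case: (boolP (x \in A)) => // /Nx; by rewrite adj_irr.
  apply/forall_inP => y; rewrite !inE => yA; apply/forall_inP => z; rewrite !inE => zA.
  apply/implyP; case/predU1P: yA => [->|yA]; case/predU1P: zA => [->|zA].
  - by rewrite eqxx.
  - by rewrite Nx.
  - by rewrite adj_sym Nx.
  - by move: clA => /forall_inP/(_ y yA)/forall_inP/(_ z zA)/implyP.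
have [||A [AM [clA|[stA cA]]]] := IHn a.+1 b M; [lia| | |].
- have e : 2 ^ (a.+1 + b.+1) = 2 * 2 ^ (a + b.+1) by rewrite addSn expnS.
  by rewrite addSnnS; move: ltN leX; rewrite e cardX; lia.
- by exists A; split; [exact: subset_trans sub_MX | left].
exists (x |: A); split; first by rewrite subUset sub1set xX (subset_trans AM).
have Nx y : y \in A -> ~~ adj x y by move=> /(subsetP AM); rewrite inE => /andP[].
right; split; last first.
  rewrite cardsU1 cA; case: (boolP (x \in A)) => // /(subsetP AM).
  by rewrite !inE eqxx.
apply/forall_inP => y; rewrite !inE => yA; apply/forall_inP => z; rewrite !inE => zA.
case/predU1P: yA => [->|yA]; case/predU1P: zA => [->|zA].
- by rewrite adj_irr.
- by rewrite Nx.
- by rewrite adj_sym Nx.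
- by move: stA => /forall_inP/(_ y yA)/forall_inP/(_ z zA).
Qed.

(** * The layered wheel *)

Section Trail.
Variables (d : nat) (letter : nat -> seq nat).

(** The vertex [(j, x)] and its upward neighbours.  A letter only selects among
    the elements of the parent's trail, so an element that is dropped once is
    lost for all further descendants. *)
Fixpoint trail (j x : nat) : seq (nat * nat) :=
  (j, x) :: if j is j'.+1 then
    [seq h <- trail j' (x %/ d) | h.1 \in letter (x %% d)] else [::].

Lemma trailS j x h : (h \in trail j.+1 x) =
  (h == (j.+1, x)) || (h.1 \in letter (x %% d)) && (h \in trail j (x %/ d)).
Proof. by rewrite inE mem_filter. Qed.

Lemma trail_self j x : (j, x) \in trail j x.
Proof. by case: j => [|j]; rewrite inE eqxx. Qed.

Lemma trail_level j x h : h \in trail j x -> h.1 <= j.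
Proof.
elim: j x => [|j IHj] x; first by rewrite inE => /eqP ->.
by rewrite trailS => /predU1P[-> //|/andP[_ /IHj]]; lia.
Qed.

Lemma trail_top j x y : (j, y) \in trail j x -> y = x.
Proof.
case: j => [|j]; first by rewrite inE => /eqP[].
by rewrite trailS => /predU1P[[//]|/andP[_ /trail_level]] /=; lia.
Qed.

Lemma trail_pred j x h : h \in trail j.+1 x -> h.1 <= j -> h \in trail j (x %/ d).
Proof. by rewrite trailS => /predU1P[-> /=|/andP[]//]; lia. Qed.

Lemma trail_column j x h : h \in trail j x -> h.2 = x %/ d ^ (j - h.1).
Proof.
elim: j x => [|j IHj] x; first by rewrite inE => /eqP -> /=; rewrite divn1.
rewrite trailS => /predU1P[-> /=|/andP[_ hP]]; first by rewrite subnn divn1.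
by rewrite (IHj _ hP) -divnMA -expnS subSn // (trail_level hP).
Qed.

(** This makes trails cliques: [k] joined the trail after [h], and the letters
    from [k] down to [(j, x)] can only have removed elements. *)
Lemma trail_chain j x h k : h \in trail j x -> k \in trail j x -> h.1 <= k.1 ->
  h \in trail k.1 k.2.
Proof.
elim: j x => [|j IHj] x; first by rewrite !inE => /eqP -> /eqP ->; rewrite inE.
rewrite !trailS => /predU1P[->|/andP[hl hP]] /predU1P[->|/andP[kl kP]] //=.
- by rewrite mem_head.
- by have := trail_level kP; rewrite leqNgt => /negP.
- by rewrite inE mem_filter hl hP orbT.
- exact: IHj hP kP.
Qed.

Lemma trail_levels_uniq j x : uniq (map fst (trail j x)).
Proof.
elim: j x => // j IHj x; rewrite /= -filter_map filter_uniq // andbT.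
apply/negP; rewrite mem_filter => /andP[_ /mapP[h /trail_level]].
by move=> + e; rewrite -e ltnn.
Qed.

Lemma trail_uniq j x : uniq (trail j x).
Proof. by have /map_uniq := trail_levels_uniq j x. Qed.

(** All elements but the first lie on distinct levels named by one letter. *)
Lemma size_trail b j x : (forall t, size (letter t) <= b) -> size (trail j x) <= b.+1.
Proof.
move=> le_b; case: j => //= j; rewrite ltnS -(size_map fst) -filter_map.
apply: leq_trans (le_b (x %% d)); apply: uniq_leq_size.
  by rewrite filter_uniq ?trail_levels_uniq.
by move=> i; rewrite mem_filter => /andP[].
Qed.

Definition wheel_adj (u v : nat * nat) : bool :=
  (u != v) && [|| u \in trail v.1 v.2, v \in trail u.1 u.2 |
    (u.1 == v.1) && ((v.2 == u.2.+1) || (u.2 == v.2.+1))].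

Lemma wheel_adj_sym : symmetric wheel_adj.
Proof.
move=> u v; rewrite /wheel_adj eq_sym; congr (_ && _).
by rewrite orbCA (eq_sym u.1) (orbC (v.2 == _)).
Qed.

Lemma wheel_adj_irr : irreflexive wheel_adj.
Proof. by move=> u; rewrite /wheel_adj eqxx. Qed.

Lemma trail_clique j x p q : p \in trail j x -> q \in trail j x -> p != q -> wheel_adj p q.
Proof.
move=> hp hq ne; rewrite /wheel_adj ne /=; case/orP: (leq_total p.1 q.1) => le.
  by rewrite (trail_chain hp hq le).
by rewrite (trail_chain hq hp le) orbT.
Qed.

Section Decomposition.
Variables (inH : pred (nat * nat)) (code : seq nat -> nat) (N : nat).
Hypothesis code_lt : forall l, code l < d.

Definition kept j x := [seq h <- trail j x | inH h].

Hypothesis letter_code : forall j x h, j <= N -> h \in kept j x ->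
  h.1 \in letter (code (map fst (kept j x))).

Definition heir j x := x * d + code (map fst (kept j x)).

Let d_gt0 : 0 < d. Proof. exact: leq_ltn_trans (code_lt [::]). Qed.

Lemma heir_div j x : heir j x %/ d = x.
Proof. by rewrite /heir divnMDl // divn_small ?addn0. Qed.

Lemma heir_mod j x : heir j x %% d = code (map fst (kept j x)).
Proof. by rewrite /heir modnMDl modn_small. Qed.

Lemma kept_heir j x : j <= N -> {subset kept j x <= kept j.+1 (heir j x)}.
Proof.
move=> le_jN h hs; have := hs; rewrite !mem_filter => /andP[-> hx] /=.
by rewrite trailS heir_mod heir_div hx letter_code // orbT.
Qed.

Fixpoint descent n j x := if n is n'.+1 then descent n' j.+1 (heir j x) else kept j x.

(** Kept trails only grow along heirs, so the core contains the kept trail of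
    [(j, x)] and all members of [H] on the chain of its heirs. *)
Definition core j x := descent (N - j) j x.

Lemma core_heir j x : j < N -> core j x = core j.+1 (heir j x).
Proof. by rewrite /core => lt_jN; rewrite -(subnSK lt_jN). Qed.

(** Induction from the last level upwards, along heirs. *)
Lemma level_ind (P : nat -> nat -> Prop) :
    (forall j x, N <= j -> P j x) ->
    (forall j x, j < N -> P j.+1 (heir j x) -> P j x) ->
  forall j x, P j x.
Proof.
move=> P_base P_step j x; move e: (N - j) => n.
elim: n j x e => [|n IHn] j x e; first by apply: P_base; lia.
by apply: P_step; [lia | apply: IHn; lia].
Qed.

Lemma core_last j x : N <= j -> core j x = kept j x.
Proof. by rewrite /core -subn_eq0 => /eqP ->. Qed.

Lemma core_is_kept j x : exists k y, core j x = kept k y.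
Proof.
rewrite /core; move: (N - j) => n; elim: n j x => [|n IHn] j x /=.
  by exists j, x.
exact: IHn.
Qed.

Lemma kept_core j x : {subset kept j x <= core j x}.
Proof.
move: j x; apply: level_ind => j x leN; first by rewrite core_last.
by move=> IH h hs; rewrite core_heir //; apply/IH/kept_heir => //; apply: ltnW.
Qed.

Lemma core_kept j x h : h \in core j x -> h.1 <= j -> h \in kept j x.
Proof.
move: j x; apply: level_ind => j x leN; first by rewrite core_last.
move=> IH; rewrite (core_heir x leN) => hc le_hj; have := IH hc (leqW le_hj).
by rewrite !mem_filter => /andP[-> /trail_pred-/(_ le_hj)]; rewrite heir_div.
Qed.

Lemma core_parent j x h : h \in core j.+1 x -> h.1 <= j -> h \in core j (x %/ d).
Proof.
move=> hc le_hj; apply: kept_core; have := core_kept hc (leqW le_hj).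
by rewrite !mem_filter => /andP[-> /trail_pred ->].
Qed.

(** Elements of a core below level [j] lie on the chain of heirs. *)
Lemma core_column j x h : h \in core j x -> j <= h.1 -> x = h.2 %/ d ^ (h.1 - j).
Proof.
move: j x; apply: level_ind => j x leN.
  rewrite core_last // mem_filter => /andP[_ hx] le_jh.
  have e : h.1 = j by apply/eqP; rewrite eqn_leq le_jh (trail_level hx).
  by rewrite (trail_column hx) e subnn !divn1.
move=> IH hc; rewrite leq_eqVlt => /predU1P[e|lt_jh].
  have := core_kept hc; rewrite -e leqnn => /(_ isT).
  by rewrite mem_filter => /andP[_ hx]; rewrite (trail_column hx) -e subnn !divn1.
rewrite core_heir // in hc; have := IH hc lt_jh => /(congr1 (divn^~ d)).
by rewrite heir_div -divnMA mulnC -expnS -subSn.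
Qed.

Lemma core_below j x h k : h \in core j x -> j <= k <= h.1 ->
  h \in core k (h.2 %/ d ^ (h.1 - k)).
Proof.
move=> hc; elim: k => [|k IHk].
  by case/andP; rewrite leqn0 => /eqP e _; subst j; rewrite -(core_column hc).
rewrite leq_eqVlt => /andP[/predU1P[e|lt_jk] le_kh].
  by rewrite -e -(core_column hc) // e.
have hk : h \in core k (h.2 %/ d ^ (h.1 - k)) by apply: IHk; lia.
have [lt_kN|le_Nk] := ltnP k N.
  by rewrite core_heir // in hk; rewrite -(core_column hk).
have := hk; rewrite core_last // mem_filter => /andP[_ /trail_level].
by lia.
Qed.

(** The vertices whose core contains [h] form a subtree of the forest of
    vertices: below [h] they are closed under parents, and from [h] upwards they
    are the successive ancestors having [h] on their chain of heirs.  The top is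
    the root of this subtree. *)
Definition core_top h j x := (h \in core j x) && ((j == 0) || (h \notin core j.-1 (x %/ d))).

Lemma core_top_uniq h j x k y : core_top h j x -> core_top h k y -> (j, x) = (k, y).
Proof.
have top_le i z : core_top h i z -> i <= h.1.
  case: i => // i /andP[hc /= /negP nh]; rewrite ltnNge; apply/negP => le_hi.
  by apply: nh; apply: core_parent.
wlog le_jk : j x k y / j <= k => [W|] jtop ktop.
  by case/orP: (leq_total j k) => [|] le; [exact: W | symmetry; exact: W].
have /andP[hj _] := jtop; have /andP[hk _] := ktop.
have ex := core_column hj (top_le _ _ jtop).
have ey := core_column hk (top_le _ _ ktop).
move: le_jk; rewrite leq_eqVlt => /predU1P[e|lt_jk]; first by rewrite ex ey e.
case: k lt_jk ktop hk ey => // k le_jk ktop hk ey.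
case/andP: (ktop) => _ /= /negP; case.
have le_kh := top_le _ _ ktop.
rewrite ey -divnMA mulnC -expnS -subSn //.
by apply: core_below hj _; apply/andP; split; last exact: ltnW.
Qed.

(** Strips are named by the vertex on their left.  The strip of [(j.+1, x)] lies
    to the right of the chain of heirs of [x %/ d] or to its left, according to
    the position of [x] with respect to the heir.  Left of the chain of column 0
    there is no vertex to name the strip, and the truncated predecessor merges it
    with strip 0. *)
Definition upper_strip j x := if heir j (x %/ d) <= x then x %/ d else (x %/ d).-1.

Definition strip_bag j x :=
  core j x ++ core j x.+1 ++
  if j is j'.+1 then core j' (upper_strip j' x) ++ core j' (upper_strip j' x).+1 else [::].

(** The strips inside a given one form a path, read from left to right, whose
    first strip hangs below the enclosing strip.  On level 0 there is no
    enclosing strip and all strips form one path. *)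
Definition strip_parent (z : nat * nat) : nat * nat :=
  let: (j, x) := z in
  if j is j'.+1 then
    if (x == 0) || (x == heir j' (x %/ d)) then (j', x %/ d) else (j, x.-1)
  else (0, x.-1).

(** The column [x.+1] either has the same parent as [x], or is the first child of
    the next vertex; then the heir of the parent of [x] is at [x] or before. *)
Lemma succ_div x : x.+1 %/ d = x %/ d \/
  [/\ x.+1 %/ d = (x %/ d).+1, x.+1 = (x %/ d).+1 * d & forall j, heir j (x %/ d) <= x].
Proof.
have def_x := divn_eq x d; have lt_m := ltn_pmod x d_gt0.
have [lt|ge] := ltnP (x %% d).+1 d.
  by left; rewrite [in LHS]def_x -addnS divnMDl // (divn_small lt) addn0.
have e : x.+1 = (x %/ d).+1 * d by rewrite mulSn; move: (x %/ d * d) def_x => y def_x; lia.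
right; split=> //; first by rewrite {1}e mulnK.
move=> j; rewrite -ltnS [X in _ < X]e /heir mulSn addnC ltn_add2r; exact: code_lt.
Qed.

(** The right boundary of a strip is a child of a boundary of the enclosing
    strip, whose core inherits all elements of which that child is not the top. *)
Lemma parent_in_strip j x h : core_top h j.+1 x.+1 = false -> h \in core j.+1 x.+1 ->
  (h \in core j (upper_strip j x)) || (h \in core j (upper_strip j x).+1).
Proof.
rewrite /core_top => + hc; rewrite hc /= => /negbFE hp.
case: (succ_div x) => [e|[e _ le]]; rewrite e in hp; rewrite /upper_strip; last first.
  by rewrite le hp orbT.
by case: ifP => _; rewrite ?hp //; case: (x %/ d) hp => [|v] /= ->; rewrite ?orbT.
Qed.

Lemma upper_strip_pred j x : x != 0 -> x != heir j (x %/ d) -> upper_strip j x.-1 = upper_strip j x.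
Proof.
case: x => // x _; rewrite /upper_strip /=; case: (succ_div x) => [->|[-> e le]] ne.
  by rewrite [_ <= x.+1]leq_eqVlt ltnS eq_sym (negPf ne).
rewrite le; case: ifP => // ge; case/eqP: ne; apply/eqP; rewrite eqn_leq ge andbT.
by rewrite {1}e /heir leq_addr.
Qed.

Lemma mem_strip_bag0 x h : (h \in strip_bag 0 x) = (h \in core 0 x) || (h \in core 0 x.+1).
Proof. by rewrite /strip_bag !mem_cat in_nil orbF. Qed.

Lemma mem_strip_bagS j x h : (h \in strip_bag j.+1 x) =
  [|| h \in core j.+1 x, h \in core j.+1 x.+1, h \in core j (upper_strip j x)
    | h \in core j (upper_strip j x).+1].
Proof. by rewrite /strip_bag !mem_cat. Qed.

(** Going up the tree of strips, [h] disappears only at the strip whose right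
    boundary is the top of [h], or at strip 0 of its level if the top is in column 0.
    Elsewhere the core of a boundary vertex shares [h] with the core of its
    parent, which bounds the enclosing strip. *)
Lemma bag_top h j x : j <= N ->
    h \in strip_bag j x ->
    ((j, x) == (0, 0)) || (h \notin strip_bag (strip_parent (j, x)).1 (strip_parent (j, x)).2) ->
  exists2 y, core_top h j y & x = y.-1.
Proof.
case: j => [|j] le_jN.
  rewrite mem_strip_bag0 /=; case: x => [|x] /=.
    by case/orP=> hc _; [exists 0 | exists 1]; rewrite /core_top ?hc.
  by rewrite mem_strip_bag0 negb_or => /orP[-> /andP[]//|hc _]; exists x.+2; rewrite // /core_top hc.
rewrite mem_strip_bagS /=; case: ifP => [first_or_heir|/norP[x0 xh]] hb /=; last first.
  rewrite mem_strip_bagS (upper_strip_pred x0 xh) prednK ?lt0n // !negb_or => /and4P[_ /negPf hx /negPf hs /negPf hs1].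
  exists x.+1 => //; case top : core_top => //; move: hb; rewrite hx hs hs1 !orbF /= => hc.
  by have := parent_in_strip top hc; rewrite hs hs1.
have strip_x : upper_strip j x = x %/ d.
  rewrite /upper_strip; case/orP: first_or_heir => /eqP e; last by rewrite -e leqnn.
  by rewrite e div0n; case: ifP.
rewrite strip_x in hb => hp.
have {hp} /norP[/negPf hv /negPf hv1] : ~~ ((h \in core j (x %/ d)) || (h \in core j (x %/ d).+1)).
  by apply: contra hp; case: (j) => [|i]; rewrite ?mem_strip_bag0 // mem_strip_bagS => /orP[->|->]; rewrite ?orbT.
have [hx|nhx] := boolP (h \in core j.+1 x).
  exists x; first by rewrite /core_top hx /= hv.
  case/orP: first_or_heir => /eqP e; first by rewrite e.
  by move: hx; rewrite e -core_heir // hv.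
move: hb; rewrite (negPf nhx) hv hv1 !orbF /= => hx.
exists x.+1 => //; case top : core_top => //.
by have := parent_in_strip top hx; rewrite strip_x hv hv1.
Qed.

End Decomposition.
End Trail.

(** * Tree decompositions of sparse induced subgraphs *)

Lemma layered_treewidth_le (H : sgraph) (D : tree_decomposition H) k :
  (forall t : td_tree D, #|bag t| <= k) -> layered_treewidth H <= k.
Proof.
move=> le_k; have [_ minT] := min_natP (layered_treewidth_ex H).
have [_ minW] := min_natP (layered_width_ex D).
apply: leq_trans (minT _ (ex_intro _ D erefl)) (minW _ _).
exists (fun=> 0%R); split; first exact: layering_cst.
by move=> t i; apply: leq_trans (subset_leq_card (subsetIl _ _)) (le_k t).
Qed.

Lemma layered_treewidth_le_card (H : sgraph) : layered_treewidth H <= #|H|.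
Proof.
have [D _] := trivial_decomposition H.
by apply: (@layered_treewidth_le _ D) => t; apply: max_card.
Qed.

Lemma card_le_size (T : finType) (U : eqType) (g : T -> U) (A : {set T}) (s : seq U) :
  injective g -> (forall x, x \in A -> g x \in s) -> #|A| <= size s.
Proof.
move=> g_inj gs; rewrite cardE -(size_map g); apply: uniq_leq_size.
  by rewrite map_inj_uniq ?enum_uniq.
by move=> u /mapP[x]; rewrite mem_enum => xA ->; apply: gs.
Qed.

Lemma size_le_card (T : finType) (U : eqType) (g : T -> U) (A : {set T}) (s : seq U) :
  uniq s -> (forall u, u \in s -> exists2 x, x \in A & g x = u) -> size s <= #|A|.
Proof.
move=> uniq_s sg; rewrite cardE -(size_map g); apply: uniq_leq_size => // u us.
by have [x xA <-] := sg u us; rewrite map_f ?mem_enum.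
Qed.

Section SparseDecomposition.
Variables (d : nat) (letter : nat -> seq nat) (code : seq nat -> nat) (N M r : nat).
Hypothesis code_lt : forall l, code l < d.
Hypothesis letter_code : forall l : seq nat,
  size l <= r -> {in l, forall i, i <= N} -> {subset l <= letter (code l)}.
Variables (H : sgraph) (g : H -> option (nat * nat)).
Hypothesis g_inj : injective g.
Hypothesis g_adj : forall x y p q, g x = Some p -> g y = Some q ->
  adj x y = wheel_adj d letter p q.
Hypothesis g_bound : forall x p, g x = Some p -> p.1 <= N /\ p.2 <= M.
Hypothesis omega_le : omega H <= r.

Let inH : pred (nat * nat) := fun p => [exists x, g x == Some p].
Let kp := kept d letter inH.

(** Kept trails are cliques of [H]. *)
Lemma size_kept_omega j x : size (kp j x) <= omega H.
Proof.
pose A := [set y | if g y is Some p then p \in kp j x else false].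
have clA : clique A.
  apply/forall_inP => y; rewrite inE; case gy: (g y) => [p|] // hp.
  apply/forall_inP => z; rewrite inE; case gz: (g z) => [q|] // hq.
  apply/implyP => ne; rewrite (g_adj gy gz).
  move: hp hq; rewrite !mem_filter => /andP[_ hp] /andP[_ hq].
  apply: trail_clique hp hq _; apply: contra ne => /eqP e.
  by apply/eqP/g_inj; rewrite gy gz e.
apply: leq_trans (leq_bigmax_cond _ clA); rewrite -(size_map Some).
apply: (@size_le_card _ _ g).
  rewrite map_inj_uniq; last by move=> ? ? [].
  by rewrite filter_uniq ?trail_uniq.
move=> u /mapP[p hp ->]; have := hp; rewrite mem_filter => /andP[/existsP[y /eqP gy] _].
by exists y; rewrite ?inE gy.
Qed.

Lemma kept_code j x h : j <= N -> h \in kp j x ->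
  h.1 \in letter (code (map fst (kp j x))).
Proof.
move=> le_jN hs; apply: letter_code; last exact: map_f.
  by rewrite size_map (leq_trans (size_kept_omega _ _)).
move=> i /mapP[p]; rewrite mem_filter => /andP[_ /trail_level le] ->.
exact: leq_trans le le_jN.
Qed.

Let cr := core d letter inH code N.
Let bs := strip_bag d letter inH code N.

Lemma size_strip_bag j x : size (bs j x) <= 4 * omega H.
Proof.
have le_core i y : size (cr i y) <= omega H.
  by have [k [z e]] := core_is_kept d letter inH code N i y; rewrite /cr e size_kept_omega.
rewrite /bs /strip_bag !size_cat; case: j => [|j].
  by apply: leq_trans (leq_add (le_core 0 x) (leq_add (le_core 0 x.+1) (leqnn 0))) _; lia.
rewrite size_cat; set s := upper_strip _ _ _ _ _ _.
apply: leq_trans (leq_add (le_core j.+1 x) (leq_add (le_core j.+1 x.+1)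
  (leq_add (le_core j s) (le_core j s.+1)))) _.
by lia.
Qed.

Definition node : finType := ('I_N.+1 * 'I_M.+1)%type.
Definition node_pos (z : node) : nat * nat := (val z.1, val z.2).
Definition node_root : node := (ord0, ord0).
Definition node_par (z : node) : node :=
  let p := strip_parent d letter inH code (node_pos z) in (inord p.1, inord p.2).
(** Level by level, from left to right: both kinds of parents come earlier. *)
Definition node_rank (z : node) : nat := z.1 * M.+1 + z.2.

Lemma node_posP z : (node_pos z).1 <= N /\ (node_pos z).2 <= M.
Proof. by split; rewrite -ltnS ltn_ord. Qed.

Lemma node_pos_inj : injective node_pos.
Proof. by move=> [a b] [c e] [/val_inj -> /val_inj ->]. Qed.

Lemma strip_parent_le p : (strip_parent d letter inH code p).1 <= p.1 /\
  (strip_parent d letter inH code p).2 <= p.2.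
Proof.
case: p => [[|j] x] /=; first by rewrite leq_pred.
by case: ifP => _ /=; rewrite ?leq_div ?leq_pred.
Qed.

Lemma node_par_pos z : node_pos (node_par z) = strip_parent d letter inH code (node_pos z).
Proof.
have [le1 le2] := strip_parent_le (node_pos z); have [b1 b2] := node_posP z.
by rewrite /node_pos /= !inordK ?ltnS -?surjective_pairing // (leq_trans _ b1, leq_trans _ b2).
Qed.

Lemma node_rank_par z : z != node_root -> node_rank (node_par z) < node_rank z.
Proof.
rewrite -(inj_eq node_pos_inj) /node_rank -[nat_of_ord _]/(node_pos (node_par z)).1.
rewrite -[nat_of_ord (node_par z).2]/(node_pos (node_par z)).2 node_par_pos.
rewrite -[nat_of_ord z.1]/(node_pos z).1 -[nat_of_ord z.2]/(node_pos z).2.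
have [_] := node_posP z; case: (node_pos z) => [[|j] x] /= le_xM.
  by case: x le_xM.
case: ifP => [_ _|/norP[x0 _] _] /=; last by rewrite ltn_add2l prednK ?lt0n.
rewrite mulSn addnC; apply: leq_trans (leq_addr _ _).
by rewrite ltn_add2r ltnS (leq_trans (leq_div _ _)).
Qed.

(** By injectivity of [g], at most one vertex has no position: the apex. *)
Definition wheel_bag (z : node) : {set H} :=
  [set x | if g x is Some p then p \in bs (node_pos z).1 (node_pos z).2 else true].

Lemma card_wheel_bag z : #|wheel_bag z| <= 4 * omega H + 1.
Proof.
apply: leq_trans (_ : size (None :: map Some (bs (node_pos z).1 (node_pos z).2)) <= _).
  apply: (card_le_size g_inj) => x; rewrite !inE; case: (g x) => [p|] //= hp.
  by rewrite map_f.
by rewrite /= size_map addn1 ltnS size_strip_bag.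
Qed.

Lemma kept_bag j x h : h \in kp j x -> h \in bs j x.
Proof.
move=> hs; rewrite /bs /strip_bag !mem_cat (kept_core _ kept_code) //.
Qed.

Lemma wheel_decomposition :
  exists D : tree_decomposition H, forall t : td_tree D, #|bag t| <= 4 * omega H + 1.
Proof.
have inord_pos p : p.1 <= N -> p.2 <= M -> node_pos (inord p.1, inord p.2) = p.
  by case: p => a b /= a_le b_le; rewrite /node_pos /= !inordK.
have kept_self x p : g x = Some p -> p \in kp p.1 p.2.
  move=> gx; rewrite mem_filter; apply/andP; split.
    by apply/existsP; exists x; rewrite gx.
  by case: (p) => j y; apply: trail_self.
have vP (v : H) : exists t : parent_tree node_rank_par, v \in wheel_bag t.
  case gv: (g v) => [p|]; last by exists node_root; rewrite inE gv.
  have [p1 p2] := g_bound gv; exists (inord p.1, inord p.2).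
  by rewrite inE gv inord_pos // kept_bag // (kept_self _ _ gv).
have eP (u v : H) : adj u v ->
    exists t : parent_tree node_rank_par, (u \in wheel_bag t) && (v \in wheel_bag t).
  move=> uv.
  case gu: (g u) => [p|]; last first.
    by have [t vt] := vP v; exists t; rewrite vt inE gu.
  case gv: (g v) => [q|]; last first.
    by have [t ut] := vP u; exists t; rewrite ut inE gv.
  move: uv; rewrite (g_adj gu gv) => /andP[_].
  have [p1 p2] := g_bound gu; have [q1 q2] := g_bound gv.
  have upward (u' v' : H) p' q' : g u' = Some p' -> g v' = Some q' ->
      p' \in trail d letter q'.1 q'.2 -> exists t : parent_tree node_rank_par,
      (u' \in wheel_bag t) && (v' \in wheel_bag t).
    move=> gu' gv' pq; have [q'1 q'2] := g_bound gv'; exists (inord q'.1, inord q'.2).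
    rewrite !inE gu' gv' inord_pos // !kept_bag ?(kept_self _ _ gv') //.
    by rewrite mem_filter pq andbT; apply/existsP; exists u'; rewrite gu'.
  have sideways (u' v' : H) p' q' : g u' = Some p' -> g v' = Some q' ->
      p'.1 = q'.1 -> q'.2 = p'.2.+1 -> exists t : parent_tree node_rank_par,
      (u' \in wheel_bag t) && (v' \in wheel_bag t).
    move=> gu' gv' e1 e2; have [p'1 p'2] := g_bound gu'; exists (inord p'.1, inord p'.2).
    have q'_core : q' \in cr p'.1 p'.2.+1.
      by rewrite -e2 e1; apply: kept_core (kept_self _ _ gv'); [exact: code_lt | exact: kept_code].
    rewrite !inE gu' gv' inord_pos // kept_bag ?(kept_self _ _ gu') //=.
    by rewrite /bs /strip_bag !mem_cat q'_core orbT.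
  case/or3P=> [pq|qp|/andP[/eqP e1 /orP[/eqP e2|/eqP e2]]].
  - exact: upward pq.
  - by have [t] := upward _ _ _ _ gv gu qp; exists t; rewrite andbC.
  - exact: sideways e1 e2.
  - by have [t] := sideways _ _ _ _ gv gu (esym e1) e2; exists t; rewrite andbC.
have sP (v : H) : connected (@induced (parent_tree node_rank_par) [set t | v \in wheel_bag t]).
  apply: parent_subtree => x y; rewrite !inE; case gv: (g v) => [p|]; last first.
    by move=> _ _; rewrite !orbF => /eqP -> /eqP ->.
  have to_pos z : (z == node_root) = (node_pos z == (0, 0)).
    by rewrite -(inj_eq node_pos_inj).
  rewrite !to_pos !node_par_pos => hx hy topx topy.
  have [x1 x2] := node_posP x; have [y1 y2] := node_posP y.
  have [a atop ea] := bag_top code_lt x1 hx topx.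
  have [b btop eb] := bag_top code_lt y1 hy topy.
  have [e1 e2] := core_top_uniq code_lt kept_code atop btop.
  have e3 : (node_pos x).2 = (node_pos y).2 by rewrite ea eb e2.
  by apply: node_pos_inj; congr (_, _); [exact: e1 | exact: e3].
exists (@TreeDecomposition H (parent_tree node_rank_par) wheel_bag
  (parent_treeP node_rank_par) vP eP sP) => t.
exact: card_wheel_bag.
Qed.

End SparseDecomposition.

(** * The graphs of the class *)

Section Alphabet.
Variables (N b : nat).

Definition level_sets : seq {set 'I_N.+1} := enum [set A : {set 'I_N.+1} | #|A| <= b].
(** Indices beyond the enumeration denote the empty set. *)
Definition letter (t : nat) : seq nat := map val (enum (nth set0 level_sets t)).
(** The value 0 for long lists is a dummy; it keeps [code_lt] unconditional. *)
Definition code (l : seq nat) : nat :=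
  if size l <= b then index [set i : 'I_N.+1 | val i \in l] level_sets else 0.

Lemma level_set_mem (l : seq nat) : size l <= b ->
  [set i : 'I_N.+1 | val i \in l] \in level_sets.
Proof.
rewrite mem_enum inE; apply: leq_trans; apply: (card_le_size val_inj) => i.
by rewrite inE.
Qed.

Lemma code_lt l : code l < size level_sets.
Proof.
rewrite /code; case: ifP => [le_b|_]; first by rewrite index_mem level_set_mem.
by have := @level_set_mem [::] isT; case: level_sets.
Qed.

Lemma letter_code l : size l <= b -> {in l, forall i, i <= N} -> {subset l <= letter (code l)}.
Proof.
move=> le_b le_N i il; rewrite /letter /code le_b nth_index ?level_set_mem //.
have i_lt : i < N.+1 by rewrite ltnS le_N.
by apply/mapP; exists (Ordinal i_lt); rewrite // mem_enum inE.
Qed.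

Lemma size_letter t : size (letter t) <= b.
Proof.
rewrite size_map -cardE; have [lt|ge] := ltnP t (size level_sets).
  by have := mem_nth set0 lt; rewrite mem_enum inE.
by rewrite nth_default // cards0.
Qed.

End Alphabet.

Section Wheel.
Variable r : nat.

(** [r.*2 + 6] is the Ramsey exponent for a clique of size [r + 5], excluded by
    [wheel_clique], or a stable set of size [r + 1]; the factor 3 accounts for
    the layers that can meet the neighbourhood of the apex. *)
Definition height : nat := 3 * 2 ^ (r.*2 + 6).
Definition arity : nat := size (level_sets height r.+1).
Lemma arity_gt0 : 0 < arity.
Proof. exact: leq_ltn_trans (code_lt height r.+1 [::]). Qed.

(** Wide enough for every descendant of column 0 of level 0. *)
Definition width : nat := arity ^ height.
Definition wheel_rel : rel (nat * nat) := wheel_adj arity (letter height r.+1).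

Definition wheel_pos (p : 'I_height.+1 * 'I_width.+1) : nat * nat := (p.1 : nat, p.2 : nat).

Definition cone_adj : rel (option ('I_height.+1 * 'I_width.+1)) := fun u v =>
  match u, v with
  | Some p, Some q => wheel_rel (wheel_pos p) (wheel_pos q)
  | None, None => false
  | _, _ => true
  end.

Lemma cone_adj_sym : symmetric cone_adj.
Proof. by move=> [p|] [q|] //=; apply: wheel_adj_sym. Qed.

Lemma cone_adj_irr : irreflexive cone_adj.
Proof. by move=> [p|] //=; apply: wheel_adj_irr. Qed.

Definition cone : sgraph := SGraph cone_adj_sym cone_adj_irr.

Lemma wheel_pos_inj : injective wheel_pos.
Proof. by move=> [a b] [c e] [/val_inj -> /val_inj ->]. Qed.

(** Seen from one of its vertices of largest level, a clique consists of upward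
    neighbours and of at most two horizontal ones. *)
Lemma wheel_clique (A : {set cone}) : clique A -> None \notin A -> #|A| <= r + 4.
Proof.
move=> clA nA; have [->|[v0 v0A]] := set_0Vmem A; first by rewrite cards0.
pose lev (v : cone) : nat := if v is Some p then p.1 : nat else 0.
pose pos (v : cone) : option (nat * nat) := omap wheel_pos v.
have pos_inj : injective pos.
  by move=> [p|] [q|] //= [e1 e2]; congr Some; apply: wheel_pos_inj; congr (_, _).
pose v := [arg max_(v > v0 in A) lev v].
have [vA vmax] : v \in A /\ forall u, u \in A -> lev u <= lev v.
  by rewrite /v; case: arg_maxnP.
clearbody v; case: v vA vmax => [p|] vA vmax; last by rewrite vA in nA.
pose tr := trail arity (letter height r.+1) p.1 p.2.
have size_tr : size tr <= r.+2 by apply: size_trail => t; apply: size_letter.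
apply: leq_trans (_ : size (map Some ((p.1 : nat, p.2.+1) :: (p.1 : nat, p.2.-1) :: tr)) <= _).
  apply: (card_le_size pos_inj) => -[q|] qA; last by rewrite qA in nA.
  rewrite /pos /= -/(map Some tr); have [->|ne] := eqVneq q p.
    by rewrite !inE map_f ?orbT // /tr; apply: trail_self.
  have := vmax _ qA; rewrite /lev => le_qp.
  have : cone_adj (Some q) (Some p).
    move: clA => /forall_inP/(_ _ qA)/forall_inP/(_ _ vA)/implyP; apply.
    by apply: contra ne => /eqP[->].
  case/andP=> _ /or3P[qp|pq|/andP[/eqP e1 /orP[/eqP e2|/eqP e2]]].
  - by rewrite !inE (map_f _ (qp : _ \in tr)) !orbT.
  - have e : p.1 = q.1 :> nat.
      by apply/eqP; rewrite eqn_leq le_qp andbT; apply: (trail_level pq).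
    rewrite /wheel_pos /= -e in pq; case/eqP: ne; apply: wheel_pos_inj.
    by congr (_, _); [exact: esym e | exact/esym/(trail_top pq)].
  - have -> : wheel_pos q = (p.1 : nat, p.2.-1).
      by congr (_, _); [exact: e1 | move: e2 => /= ->].
    by rewrite !inE eqxx orbT.
  - have -> : wheel_pos q = (p.1 : nat, p.2.+1) by congr (_, _); [exact: e1 | exact: e2].
    by rewrite !inE eqxx.
by rewrite size_map /=; move: size_tr; lia.
Qed.

Definition row (j : 'I_height.+1) : {set cone} :=
  [set v | if v is Some p then p.1 == j else false].

Lemma row_connected j : connected_set (row j).
Proof.
split; first by apply/set0Pn; exists (Some (j, ord0)); rewrite inE eqxx.
have from0 (x : 'I_width.+1) : connect (within (row j)) (Some (j, ord0)) (Some (j, x)).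
  case: x => x; elim: x => [|x IHx] lt_x.
    by rewrite (_ : Ordinal lt_x = ord0) //; apply: val_inj.
  apply: connect_trans (IHx (ltnW lt_x)) (connect1 _).
  rewrite /within !inE !eqxx /=; apply/andP; split; last by rewrite /= !eqxx !orbT.
  by rewrite xpair_eqE (ltn_eqF (ltnSn x)) andbF.
move=> [[a x]|] [[c y]|]; rewrite !inE // => /eqP /= -> /eqP /= ->.
apply: connect_trans (from0 y).
by rewrite (sym_connect_sym (@within_sym _ _)); apply: from0.
Qed.

Lemma touching_sym (G : sgraph) (A B : {set G}) : touching A B -> touching B A.
Proof. by case=> x [y [xA yB xy]]; exists y, x; rewrite eq_sym adj_sym. Qed.

(** Always take the child whose letter is the level [i] alone. *)
Lemma deep_child i k : i <= height -> exists2 x, x < arity ^ k &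
  (i, 0) \in trail arity (letter height r.+1) (i + k) x.
Proof.
move=> le_i; elim: k => [|k [x lt_x ix]].
  by exists 0; rewrite ?expn0 // addn0; apply: trail_self.
have lt_c := code_lt height r.+1 [:: i].
exists (x * arity + code height r.+1 [:: i]).
  rewrite expnSr; apply: leq_trans (_ : x.+1 * arity <= _); last by rewrite leq_mul2r lt_x orbT.
  by rewrite mulSn addnC ltn_add2r.
rewrite addnS trailS modnMDl modn_small // divnMDl ?arity_gt0 // divn_small // addn0 ix andbT.
by rewrite letter_code ?mem_head ?orbT // => m; rewrite inE => /eqP ->.
Qed.

Lemma rows_touch i j : touching (row i) (row j).
Proof.
wlog le_ij : i j / i <= j => [W|].
  by case/orP: (leq_total i j) => le; [exact: W | apply/touching_sym/W].
have [x lt_x ix] := @deep_child i (j - i) (ltn_ord i : i <= height).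
have x_ord : x < width.+1.
  rewrite ltnS; apply: leq_trans (ltnW lt_x) _.
  rewrite /width leq_pexp2l ?arity_gt0 //; apply: leq_trans (leq_subr _ _) _.
  by rewrite -ltnS.
exists (Some (i, ord0)), (Some (j, Ordinal x_ord)); split; rewrite ?inE //.
case: eqVneq => //= ne; rewrite /wheel_rel /wheel_adj /wheel_pos /=.
rewrite subnKC // in ix; rewrite ix /= andbT.
by apply: contra ne => /eqP [e1 e2]; apply/eqP; congr (Some (_, _)); apply: val_inj.
Qed.

Lemma indep_in_layer (D : tree_decomposition cone) (L : cone -> int) (t : td_tree D) i :
    alpha (induced (bag t :&: layer L i)) <= r ->
  #|(bag t :\ None) :&: layer L i| < 2 ^ (r.*2 + 6).
Proof.
move=> le_r; rewrite ltnNge; apply/negP.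
have -> : r.*2 + 6 = (r + 5) + r.+1 by lia.
move=> /ramsey_pow[A [/subsetP sA [[clA cA]|[stA cA]]]].
  have nA : None \notin A by apply/negP => /sA; rewrite !inE eqxx.
  by have := wheel_clique clA nA; rewrite cA; lia.
pose S := bag t :&: layer L i.
have AS x : x \in A -> x \in S by move=> /sA; rewrite !inE -andbA => /and3P[_ -> ->].
pose A' := [set x : induced S | val x \in A].
have stA' : stable A'.
  apply/forall_inP => x; rewrite inE => xA; apply/forall_inP => y; rewrite inE => yA.
  by move: stA => /forall_inP/(_ _ xA)/forall_inP/(_ _ yA).
have : r.+1 <= #|A'|.
  rewrite -cA cardE; apply: (@size_le_card _ _ val); first exact: enum_uniq.
  move=> u; rewrite mem_enum => uA; exists (Sub u (AS u uA) : induced S) => //.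
  by rewrite inE.
rewrite ltnNge => /negP; apply; apply: leq_trans le_r.
exact: leq_trans (leq_bigmax_cond _ stA').
Qed.

(** The levels form a bramble, so some bag meets all of them; it is spread over
    the three layers around that of the apex. *)
Lemma cone_layered_tree_indep : r < layered_tree_independence_number cone.
Proof.
rewrite ltnNge; apply/negP => le_r.
have [[D eD] _] := min_natP (layered_tree_indep_ex cone).
have [[L [layL indepL]] _] := min_natP (layered_indep_ex D).
have [t tP] := bramble_bag D row_connected rows_touch.
have small i : #|(bag t :\ None) :&: layer L i| < 2 ^ (r.*2 + 6).
  apply: indep_in_layer; apply: leq_trans (indepL t i) _.
  by rewrite -/(layered_independence_number D) eD.
pose X := bag t :\ None.
have big : height < #|X|.
  pose lev (v : cone) : 'I_height.+1 := if v is Some p then p.1 else ord0.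
  rewrite -[height.+1]card_ord -cardsT; apply: leq_trans (leq_imset_card lev X).
  apply: subset_leq_card; apply/subsetP => j _.
  have /set0Pn[[p|]] := tP j; rewrite !inE ?andbF // => /andP[pt /eqP pj].
  by apply/imsetP; exists (Some p); rewrite // !inE.
pose a := L None.
have cover : X \subset (X :&: layer L (a - 1)) :|: (X :&: layer L a) :|: (X :&: layer L (a + 1)).
  apply/subsetP => v; rewrite !inE => /andP[vN vt]; rewrite vN vt /=.
  have : (`|L v - L None| <= 1)%R by apply: layL; case: v vN {vt}.
  by rewrite -/a; lia.
have := leq_trans (subset_leq_card cover) (leq_card_setU _ _).
have [+ _] := leq_card_setU (X :&: layer L (a - 1)) (X :&: layer L a).
have := small (a - 1)%R; have := small a; have := small (a + 1)%R.
rewrite -/X; move: big; rewrite /height; move: (2 ^ _) => P. lia.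
Qed.

End Wheel.

(** * The theorem *)

Definition embeds (H G : sgraph) : Prop :=
  exists f : H -> G, injective f /\ forall x y, adj (f x) (f y) = adj x y.

Lemma embeds_trans (F G H : sgraph) : embeds F G -> embeds G H -> embeds F H.
Proof.
move=> [f [f_inj fE]] [g [g_inj gE]]; exists (g \o f).
by split=> [|x y]; [exact: inj_comp | rewrite /= gE].
Qed.

Lemma embeds_induced (G : sgraph) (S : {set G}) : embeds (induced S) G.
Proof. by exists val; split=> //; apply: val_inj. Qed.

(** Up to isomorphism, the induced subgraphs of the cones. *)
Definition cone_class (H : sgraph) : Prop :=
  nonempty_graph H /\ exists r, embeds H (cone r).

Lemma cone_class_graph_class : graph_class cone_class.
Proof.
split=> [H []//|G H [f [[g fK gK] fE]] [G_gt0 [r Gr]]]; split.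
  by rewrite /nonempty_graph -(bij_eq_card (Bijective fK gK)).
exists r; apply: embeds_trans Gr; exists g; split; first exact: can_inj gK.
by move=> x y; rewrite -fE !gK.
Qed.

Lemma cone_class_hereditary : hereditary cone_class.
Proof.
move=> G S /set0Pn[x xS] [_ [r Gr]]; split; last first.
  by exists r; apply: embeds_trans (embeds_induced S) Gr.
by apply/card_gt0P; exists (Sub x xS).
Qed.

Lemma layered_treewidth_low_omega (H : sgraph) r : embeds H (cone r) -> omega H <= r.+1 ->
  layered_treewidth H <= 4 * omega H + 1.
Proof.
move=> [f [f_inj fE]] le_r.
pose g x := omap (@wheel_pos r) (f x).
have [|||||D leD] := @wheel_decomposition (arity r) (letter (height r) r.+1)
    (code (height r) r.+1) (height r) (width r) r.+1 _ _ H g _ _ _ le_r.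
- exact: code_lt.
- exact: letter_code.
- move=> x y; rewrite /g => e; apply: f_inj; move: e.
  by case: (f x) (f y) => [p|] [q|] //= [e1 e2]; congr Some; apply: wheel_pos_inj; congr (_, _).
- move=> x y p q; rewrite /g -fE; case: (f x) => [p'|] // [<-].
  by case: (f y) => [q'|] // [<-].
- move=> x p; rewrite /g; case: (f x) => [p'|] // [<-].
  by rewrite -ltnS ltn_ord -ltnS ltn_ord.
exact: layered_treewidth_le leD.
Qed.

Theorem theorem7p2 :
  exists C : sgraph -> Prop,
    graph_class C /\ hereditary C /\
    (forall r : nat, 1 <= r ->
       bounded_on layered_treewidth (omega_at_most C r)) /\
    ~ bounded_on layered_tree_independence_number C.
Proof.
exists cone_class; split; first exact: cone_class_graph_class.
split; first exact: cone_class_hereditary.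
split=> [s _|[c le_c]].
  exists ((4 * s + 1) + \sum_(r < s) #|cone r|) => H [[_ [r Hr]] omega_s].
  have [le_sr|lt_rs] := leqP s r.
    apply: leq_trans (layered_treewidth_low_omega Hr _) _; last first.
      by apply: leq_trans (leq_addr _ _); rewrite leq_add2r leq_mul2l.
    exact: leq_trans omega_s (leqW le_sr).
  apply: leq_trans (layered_treewidth_le_card H) _.
  have [f [f_inj _]] := Hr; apply: leq_trans (leq_card f f_inj) _.
  by apply: leq_trans (leq_addl _ _); rewrite (bigD1 (Ordinal lt_rs)) //= leq_addr.
have : cone_class (cone c).
  split; first by apply/card_gt0P; exists None.
  by exists c, id; split.
by move=> /le_c; rewrite leqNgt cone_layered_tree_indep.
Qed.
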